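(* For every composition $\alpha$, the number of maximal chains from the empty composition $\varnothing$ to $\alpha$ in the poset $\mathcal{R}_c$ (that is, the number of sequences $\varnothing=\alpha^{(0)}\lessdot_r\alpha^{(1)}\lessdot_r\cdots\lessdot_r\alpha^{(n)}=\alpha$) equals the number of standard reverse composition tableaux of shape $\alpha$.
   Context: Compositions have positive parts; $\varnothing$ is the empty composition. Operators: for $i\geq1$, $\mathfrak{d}_i(\alpha)$ subtracts $1$ from the rightmost part of $\alpha$ equal to $i$ (deleting a resulting $0$), and is $0$ if there is no such part; operators send $0$ to $0$. $\mathfrak{v}_{[i-1]}=\mathfrak{d}_1\cdots\mathfrak{d}_{i-1}$ ($\mathfrak{d}_{i-1}$ applied first; $\mathfrak{v}_{[0]}=\mathrm{id}$), $a_i$ appends a part $i$ at the end, $u_i=a_i\mathfrak{v}_{[i-1]}$. The poset $\mathcal{R}_c$ on compositions has cover relation $\alpha\lessdot_r\beta$ iff $\beta=u_i(\alpha)$ for some $i\geq1$, and its order is the transitive closure. An SRCT of shape $\alpha\vDash m$ (reverse composition diagram: row $r$ from the top has $\alpha_r$ left-justified boxes) is a bijective filling $\tau$ by $\{1,\ldots,m\}$ with rows decreasing left to right, first column increasing top to bottom, and such that for rows $r<s$ and column $c$ with $(s,c+1)$ a box, if $\tau(r,c)>\tau(s,c+1)$ then $(r,c+1)$ is a box and $\tau(r,c+1)>\tau(s,c+1)$. *)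

(* Defs.v *)
From mathcomp Require Import all_boot.
Set Implicit Arguments. Unset Strict Implicit. Unset Printing Implicit Defensive.

(* A composition: a finite sequence of positive integers; [::] is the empty
   composition.  The operator value "0" is modelled by None. *)
Definition composition (s : seq nat) : bool := all (fun x => 0 < x) s.

Definition d_seq (i : nat) (s : seq nat) : option (seq nat) :=
  if i \in s then
    let r := rev s in
    let j := index i r in
    Some (rev (take j r ++ (if i.-1 == 0 then [::] else [:: i.-1]) ++ drop j.+1 r))
  else None.

Definition d_op (i : nat) (o : option (seq nat)) : option (seq nat) :=
  if o is Some s then d_seq i s else None.

Fixpoint v_op (k : nat) (o : option (seq nat)) : option (seq nat) :=
  match k with
  | 0 => o
  | k'.+1 => v_op k' (d_op k'.+1 o)
  end.

Definition a_op (i : nat) (o : option (seq nat)) : option (seq nat) :=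
  omap (fun s => rcons s i) o.

Definition u_op (i : nat) (o : option (seq nat)) : option (seq nat) :=
  a_op i (v_op i.-1 o).

Definition rcover (alpha beta : seq nat) : Prop :=
  exists2 i, 1 <= i & u_op i (Some alpha) = Some beta.

Fixpoint cover_path (x : seq nat) (p : seq (seq nat)) : Prop :=
  match p with
  | [::] => True
  | y :: p' => rcover x y /\ cover_path y p'
  end.

Definition max_chain (alpha : seq nat) (c : seq (seq nat)) : Prop :=
  exists2 rest, c = [::] :: rest & cover_path [::] rest /\ last [::] rest = alpha.

(* Standard reverse composition tableaux.  tau is the list of rows (top to
   bottom); entry (r,c) (0-indexed) is nth 0 (nth [::] tau r) c; (r,c) is a
   box iff c < alpha_r. *)
Definition tab_entry (tau : seq (seq nat)) (r c : nat) : nat :=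
  nth 0 (nth [::] tau r) c.

Definition SRCT (alpha : seq nat) (tau : seq (seq nat)) : Prop :=
  [/\ map size tau = alpha,
      perm_eq (flatten tau) (iota 1 (sumn alpha)),
      (forall r c, r < size alpha -> c.+1 < nth 0 alpha r ->
         tab_entry tau r c.+1 < tab_entry tau r c),
      (forall r s, r < s -> s < size alpha ->
         tab_entry tau r 0 < tab_entry tau s 0) &
      (forall r s c, r < s -> s < size alpha -> c < nth 0 alpha r ->
         c.+1 < nth 0 alpha s ->
         tab_entry tau s c.+1 < tab_entry tau r c ->
         c.+1 < nth 0 alpha r /\ tab_entry tau s c.+1 < tab_entry tau r c.+1)].

(* Main.v *)
Require Import Defs.
From mathcomp Require Import all_boot zify.

(* Inserting the entries of an SRCT in decreasing order, the triple condition
   says that each entry either starts a new top row or extends the topmost row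
   of its length.  So SRCTs are the chains for the operators t_j, where t_1
   prepends a part 1 and t_j increments the leftmost part j-1.  The operators
   t_j act from the left and the u_i from the right, and for a fixed composition
   t_j u_i = u_i t_j, except that t_j u_i = u_j t_i when |i - j| = 1 and the
   composition has no part min(i, j).  Hence "sum over j of t_j" and "sum over i
   of u_i" commute; as they agree on the empty composition, so do their n-th
   iterates. *)
Set Implicit Arguments. Unset Strict Implicit. Unset Printing Implicit Defensive.

(** * The operators [t_op] and [d_seq] seen from the last part *)

Fixpoint incr_first k s :=
  if s is x :: s' then
    if x == k then Some (k.+1 :: s') else omap (cons x) (incr_first k s')
  else None.

Definition t_op j s := if j == 1 then Some (1 :: s) else incr_first j.-1 s.

Lemma incr_first_rcons k s x :
  incr_first k (rcons s x) =
  if incr_first k s is Some s' then Some (rcons s' x)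
  else if x == k then Some (rcons s k.+1) else None.
Proof.
elim: s => [|y s IH] //=.
case: eqP => // _; rewrite IH; case: (incr_first k s) => //=.
by case: eqP.
Qed.

(** The commutation proofs peel off the last part, where [d_seq] looks first. For [j = 1] the first
    branch always applies. *)
Lemma t_op_rcons j s x : 0 < j ->
  t_op j (rcons s x) =
  if t_op j s is Some s' then Some (rcons s' x)
  else if x == j.-1 then Some (rcons s j) else None.
Proof. by case: j => // -[|j] _ //; rewrite /t_op /= incr_first_rcons. Qed.

Lemma t_opP j s : 0 < j -> isSome (t_op j s) = (j == 1) || (j.-1 \in s).
Proof.
case: j => // -[|j] _ //; rewrite /t_op /=.
elim: s => //= x s IH; rewrite inE eq_sym; case: eqP => //= _.
by rewrite -IH; case: (incr_first _ _).
Qed.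

Lemma d_seq_rcons_eq i s :
  d_seq i (rcons s i) = Some (s ++ if i.-1 == 0 then [::] else [:: i.-1]).
Proof.
rewrite /d_seq mem_rcons mem_head rev_rcons /= eqxx /= drop0 rev_cat revK.
by case: (i.-1 == 0).
Qed.

Lemma d_seq_rcons_neq i s x : x != i ->
  d_seq i (rcons s x) = omap (rcons^~ x) (d_seq i s).
Proof.
move=> nxi; rewrite /d_seq mem_rcons inE eq_sym (negPf nxi) /=.
case: (i \in s) => //=; rewrite rev_rcons /= (negPf nxi) /=.
by rewrite rev_cons.
Qed.

Lemma d_seqP i s : isSome (d_seq i s) = (i \in s).
Proof. by rewrite /d_seq; case: (i \in s). Qed.

Lemma d_seqN i s : i \notin s -> d_seq i s = None.
Proof. by rewrite /d_seq => /negPf ->. Qed.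

Lemma t_opN j s : 0 < j -> t_op j s = None -> (j != 1) && (j.-1 \notin s).
Proof. by move=> j0 E; have := t_opP s j0; rewrite E /= -negb_or => <-. Qed.

Lemma sumn_d_seq i s s' : 0 < i -> d_seq i s = Some s' -> sumn s = (sumn s').+1.
Proof.
move=> i0; elim/last_ind: s s' => [|s x IH] s'; first by rewrite /d_seq.
rewrite sumn_rcons; have [->|nxi] := eqVneq x i.
  by rewrite d_seq_rcons_eq => -[<-]; rewrite sumn_cat; case: eqP => /=; lia.
rewrite d_seq_rcons_neq //; case E: (d_seq i s) => [y|] //= [<-].
by rewrite sumn_rcons (IH _ E).
Qed.

Lemma mem_d_seq i k s s' : d_seq i s = Some s' -> 0 < i -> k != i -> k != i.-1 ->
  (k \in s') = (k \in s).
Proof.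
move=> H i0 nk nk'; elim/last_ind: s s' H => [|s x IH] s'; first by rewrite /d_seq.
have [->|nxi] := eqVneq x i.
  rewrite d_seq_rcons_eq => -[<-]; rewrite mem_rcons inE (negPf nk) mem_cat /=.
  by case: eqP; rewrite ?inE ?(negPf nk') ?orbF.
rewrite d_seq_rcons_neq //; case E: (d_seq i s) => [y|] //= [<-].
by rewrite !mem_rcons !inE (IH _ E).
Qed.

Lemma d_seq_pred i s s' : d_seq i.+2 s = Some s' -> i.+1 \in s'.
Proof.
elim/last_ind: s s' => [|s x IH] s'; first by rewrite /d_seq.
have [->|nxi] := eqVneq x i.+2.
  by rewrite d_seq_rcons_eq => -[<-]; rewrite mem_cat inE eqxx orbT.
rewrite d_seq_rcons_neq //; case E: (d_seq i.+2 s) => [y|] //= [<-].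
by rewrite mem_rcons inE (IH _ E) orbT.
Qed.

(** * Commutation of [t_op] with [d_seq] and [v_op] *)

Lemma t_op_rcons_Some j s x s' : 0 < j -> t_op j s = Some s' ->
  t_op j (rcons s x) = Some (rcons s' x).
Proof. by move=> j0 E; rewrite t_op_rcons // E. Qed.

(** For [k != j] neither operator creates a part that the other looks for. They compete only if
    [k = j - 1], where [t_op] takes the leftmost such part and [d_seq] the rightmost; if there is
    just one, both orders are undefined. *)
Lemma t_d_comm j k s : 0 < j -> 0 < k -> k != j ->
  obind (t_op j) (d_seq k s) = obind (d_seq k) (t_op j s).
Proof.
move=> j0 k0 nkj; elim/last_ind: s => [|s x IH].
  case: j j0 nkj {k0} => // -[|j] _ //= nk; rewrite /t_op //=.
  by rewrite /d_seq inE (negPf nk).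
have [->|nxk] := eqVneq x k.
  rewrite d_seq_rcons_eq /= t_op_rcons //.
  case Et: (t_op j s) => [s'|] /=.
    rewrite d_seq_rcons_eq; case: eqP => [_|_]; first by rewrite !cats0.
    by rewrite !cats1 (t_op_rcons_Some _ _ Et).
  have /andP [j1 js] := t_opN j0 Et.
  have [kj|nkj'] := eqVneq k j.-1 => /=.
    rewrite d_seq_rcons_neq 1?eq_sym // d_seqN ?kj //=.
    case: eqP => [_|_]; rewrite ?cats0 // ?cats1 t_op_rcons // Et.
    by case: eqP => //; lia.
  case: eqP => [_|_]; rewrite ?cats0 // ?cats1 t_op_rcons // Et.
  by case: eqP => //; lia.
rewrite d_seq_rcons_neq // t_op_rcons //.
case Ed: (d_seq k s) IH => [s1|] /=; case Et: (t_op j s) => [s2|] /= IH.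
- rewrite t_op_rcons // d_seq_rcons_neq // -IH; case E: (t_op j s1) => [//|] /=.
  have /andP [j1 js] := t_opN j0 E.
  case: eqP => // xj; have := t_opP s j0; rewrite Et /= (negPf j1) /=.
  by rewrite -(mem_d_seq Ed) ?(negPf js) -?xj //; lia.
- rewrite t_op_rcons // IH; case: eqP => //= _.
  by rewrite d_seq_rcons_neq 1?eq_sym // Ed.
- by rewrite d_seq_rcons_neq // -IH.
- by case: eqP => //= _; rewrite d_seq_rcons_neq 1?eq_sym // Ed.
Qed.

(** The lowered [j] becomes the only part [j - 1], so [t_op j] raises it again. *)
Lemma t_d_cancel j s : 0 < j -> j \in s -> t_op j s = None ->
  obind (t_op j) (d_seq j s) = Some s.
Proof.
move=> j0; elim/last_ind: s => [|s x IH] // js tN.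
have /andP [j1] := t_opN j0 tN.
rewrite mem_rcons inE negb_or => /andP [jx jns].
have ts : t_op j s = None.
  by case E: (t_op j s) (t_opP s j0) => //; rewrite (negPf j1) (negPf jns).
have [xj|nxj] := eqVneq x j.
  rewrite {}xj d_seq_rcons_eq /=.
  have -> : j.-1 == 0 = false by lia.
  by rewrite cats1 t_op_rcons // ts eqxx.
have js' : j \in s by move: js; rewrite mem_rcons inE eq_sym (negPf nxj).
rewrite d_seq_rcons_neq //; move: (IH js' ts).
by case: (d_seq j s) => //= s1 E; rewrite t_op_rcons // E.
Qed.

(** If the leftmost [j - 1] precedes the rightmost [j], the operators act on different parts. If it
    follows, each order undoes its own first step and returns [s]. For [j = 1], the prepended 1 is
    not the deleted one. *)
Lemma t_d_comm_same j s : 0 < j -> j \in s -> isSome (t_op j s) ->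
  obind (t_op j) (d_seq j s) = obind (d_seq j) (t_op j s).
Proof.
move=> j0; elim/last_ind: s => [|s x IH] // js ts.
rewrite t_op_rcons //; have [xj|nxj] := eqVneq x j.
  rewrite {x}xj in js ts *; rewrite d_seq_rcons_eq /=.
  case Et: (t_op j s) => [s'|].
    rewrite /= d_seq_rcons_eq; case: eqP => _; rewrite ?cats0 // !cats1.
    exact: t_op_rcons_Some Et.
  by move: ts; rewrite t_op_rcons // Et; case: eqP => //; lia.
have js' : j \in s by move: js; rewrite mem_rcons inE eq_sym (negPf nxj).
rewrite d_seq_rcons_neq //.
case Ed: (d_seq j s) IH (d_seqP j s) => [s1|]; rewrite js' //= => /(_ isT) IH _.
case Et: (t_op j s) IH => [s'|] /= IH.
  have {}IH := IH isT.
  rewrite d_seq_rcons_neq // -IH t_op_rcons //.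
  case E: (t_op j s1) => [//|] /=; have /andP [j1 jn] := t_opN j0 E.
  by case: j j0 j1 jn Ed {E Et IH js ts js' nxj} => // -[|j] // _ _ /= jn /d_seq_pred; rewrite (negPf jn).
have /eqP xj : x == j.-1 by move: ts; rewrite t_op_rcons // Et; case: eqP.
rewrite -xj eqxx /= xj d_seq_rcons_eq t_op_rcons //.
have [j1 _] := andP (t_opN j0 Et).
have -> : j.-1 == 0 = false by lia.
have := t_d_cancel j0 js' Et; rewrite Ed /= => ->.
by rewrite cats1.
Qed.

(** The part [j] created by [t_op] is the only one, so [d_seq j] lowers it back. *)
Lemma d_t_cancel j s s' : 0 < j -> j \notin s -> t_op j s = Some s' ->
  d_seq j s' = Some s.
Proof.
move=> j0; elim/last_ind: s s' => [|s x IH] s'.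
  by case: j j0 => // -[|j] // _ _; rewrite /t_op /= => -[<-].
rewrite mem_rcons inE negb_or eq_sym => /andP [nxj js].
rewrite t_op_rcons //; case Et: (t_op j s) => [s1|].
  by move=> [<-]; rewrite d_seq_rcons_neq // (IH s1).
have /andP [j1 _] := t_opN j0 Et.
case: eqP => // -> [<-]; rewrite d_seq_rcons_eq.
have -> : j.-1 == 0 = false by lia.
by rewrite cats1.
Qed.

Lemma v_op_None k : v_op k None = None.
Proof. by elim: k. Qed.

Lemma t_v_comm_lt j k o : k < j -> obind (t_op j) (v_op k o) = v_op k (obind (t_op j) o).
Proof.
elim: k o => //= k IH o kj; rewrite IH ?(ltnW kj) //.
by case: o => //= s; rewrite t_d_comm //; lia.
Qed.

(** Only the factor [d_seq j] of [v_op k] is critical. It acts right after [d_seq j.+1], which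
    leaves a part [j]; for [j = k] that part is assumed. *)
Lemma t_v_comm j k s : 0 < j -> (j < k) || (j == k) && (j \in s) ->
  obind (t_op j) (v_op k (Some s)) = v_op k (t_op j s).
Proof.
move=> j0; elim: k s => [|k IH] s; first by case: j j0.
have [-> /=|nkj] := eqVneq j k.+1; last first.
  rewrite orbF ltnS => jk /=; have := @t_d_comm j k.+1 s j0 isT.
  rewrite eq_sym -[d_op _ (t_op j s)]/(obind (d_seq k.+1) (t_op j s)) => /(_ nkj) <-.
  case Ed: (d_seq k.+1 s) => [y|] /=; last by rewrite !v_op_None.
  apply: IH; case: ltngtP jk => //= jk _.
  by move: Ed; rewrite jk; case: k jk {nkj} => [|k] jk; [lia | apply: d_seq_pred].
rewrite ltnn /= => js; rewrite t_v_comm_lt //.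
case Et: (t_op k.+1 s) => [s'|].
  by rewrite -[d_op _ (Some s')]/(obind (d_seq k.+1) (Some s')) -Et t_d_comm_same // Et.
(* [t_op k.+1] undoes [d_seq k.+1], but [s] has no part [k], so the next factor [d_seq k] is
   undefined, like the right-hand side. *)
rewrite t_d_cancel // v_op_None; have := @t_opN k.+1 s isT Et.
case: k {IH js Et j0 j} => //= k ks.
by rewrite d_seqN ?v_op_None.
Qed.

Lemma mem_v_op k i s s' : k < i -> v_op k (Some s) = Some s' ->
  (i \in s') = (i \in s).
Proof.
elim: k s => [|k IH] s ki /=; first by case=> ->.
case Ed: (d_seq k.+1 s) => [y|] /=; last by rewrite v_op_None.
by move=> /IH -> //; [apply: mem_d_seq Ed _ _ _; lia | lia].
Qed.

Lemma sumn_v_op k s s' : v_op k (Some s) = Some s' -> sumn s = sumn s' + k.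
Proof.
elim: k s => [|k IH] s /=; first by case=> ->; rewrite addn0.
case Ed: (d_seq k.+1 s) => [y|] /=; last by rewrite v_op_None.
by move=> /IH Ey; rewrite (sumn_d_seq _ Ed) // Ey; lia.
Qed.

(** * Exchange of [t_op] and [u_op] *)

Definition u_seq i s := u_op i (Some s).

(* The exceptional case, in which exchanging t and u also exchanges their indices. *)
Definition swapped i j (s : seq nat) :=
  ((j == i.+1) || (i == j.+1)) && (minn i j \notin s).

Lemma t_a_comm i j s : 0 < j -> i != j.-1 ->
  t_op j (rcons s i) = omap (rcons^~ i) (t_op j s).
Proof. by move=> j0 ij; rewrite t_op_rcons // (negPf ij); case: (t_op j s). Qed.

(** [t_op j] passes [v_op i.-1], where the case [j = i - 1] uses the part [j] guaranteed by
    [~~ swapped]. It then passes the appended [i]: if [j = i + 1], another part [i] survives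
    [v_op i.-1] further left and is raised instead. *)
Lemma t_u_comm i j s : 0 < i -> 0 < j -> ~~ swapped i j s ->
  obind (t_op j) (u_seq i s) = obind (u_seq i) (t_op j s).
Proof.
move=> i0 j0 ns; rewrite /u_seq /u_op.
have -> : obind (fun s0 => a_op i (v_op i.-1 (Some s0))) (t_op j s) =
          a_op i (v_op i.-1 (t_op j s)).
  by case: (t_op j s) => //=; rewrite v_op_None.
have -> : v_op i.-1 (t_op j s) = obind (t_op j) (v_op i.-1 (Some s)).
  have [ij|ji] := ltnP i.-1 j; first by rewrite t_v_comm_lt.
  rewrite t_v_comm //; have [E|nji] /= := eqVneq j i.-1; last by rewrite orbF; lia.
  subst j; rewrite ltnn /=; move: ns; rewrite /swapped.
  have -> : i == i.-1.+1 by lia.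
  by rewrite orbT /= negbK; have -> : minn i i.-1 = i.-1 by lia.
case Ev: (v_op i.-1 (Some s)) => [y|] //=.
have [ij|nij] := eqVneq i j.-1; last by rewrite t_a_comm.
move: ns; rewrite /swapped; have -> : j == i.+1 by lia.
have -> /= : minn i j = i by lia.
rewrite negbK -(@mem_v_op i.-1 i _ y) //; last by lia.
move=> iy; rewrite t_op_rcons //.
by have := t_opP y j0; rewrite -ij iy orbT; case: (t_op j y).
Qed.

(** The appended [i] is the only one, so [t_op i.+1] raises it; on the right, [d_seq i] is the first
    factor of [v_op i] and undoes [t_op i]. Both sides append [i.+1] to [v_op i.-1] of [s]. *)
Lemma t_u_swap i s : 0 < i -> i \notin s ->
  obind (t_op i.+1) (u_seq i s) = obind (u_seq i.+1) (t_op i s).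
Proof.
move=> i0 ns; have -> : obind (u_seq i.+1) (t_op i s) =
   a_op i.+1 (v_op i.-1 (if t_op i s is Some _ then Some s else None)).
  case Et: (t_op i s) => [s'|] /=; last by rewrite v_op_None.
  case: i i0 ns Et => // i _ ns Et.
  by rewrite /u_seq /u_op /= (d_t_cancel _ ns Et).
rewrite /u_seq /u_op.
have -> : v_op i.-1 (if t_op i s is Some _ then Some s else None) = v_op i.-1 (Some s).
  (* If [t_op i s] is undefined, [i - 1] is positive and missing from [s], so [v_op i.-1] is
     undefined as well. *)
  case Et: (t_op i s) => [//|]; have := t_opN i0 Et.
  rewrite v_op_None; case: i i0 ns Et => // -[|i] // _ _ _ /= is0.
  by rewrite d_seqN // v_op_None.
case Ev: (v_op i.-1 (Some s)) => [y|] //=.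
have /negPf iy : i \notin y by rewrite (@mem_v_op i.-1 i s y) // prednK.
rewrite t_op_rcons //= eqxx.
by have := @t_opP i.+1 y isT; rewrite /= iy orbF eqSS (gtn_eqF i0); case: (t_op _ _).
Qed.

Lemma t_u_swap_None i s : 0 < i -> i \notin s ->
  obind (t_op i) (u_seq i.+1 s) = obind (u_seq i) (t_op i.+1 s).
Proof.
move=> i0 ns; rewrite /u_seq /u_op /=.
have -> : t_op i.+1 s = None.
  by have := @t_opP i.+1 s isT; rewrite /= (negPf ns) orbF eqSS (gtn_eqF i0); case: (t_op _ _).
by case: i i0 ns => // i _ ns; rewrite /= d_seqN // v_op_None.
Qed.

(** [swapped] is symmetric in its indices, so this is an involution on index pairs; it turns the
    exchange rules into a reindexing. *)
Definition conj_pair s (p : nat * nat) := if swapped p.1 p.2 s then (p.2, p.1) else p.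

Lemma t_u_conj i j s : 0 < i -> 0 < j ->
  obind (t_op j) (u_seq i s) =
  obind (u_seq (conj_pair s (i, j)).1) (t_op (conj_pair s (i, j)).2 s).
Proof.
move=> i0 j0; rewrite /conj_pair /=; case: ifP => [|/negbT] ns; last exact: t_u_comm.
move: ns => /= /andP [/orP [/eqP E|/eqP E]]; subst.
  by have -> : minn i i.+1 = i by [lia]; move=> ns; apply: t_u_swap.
by have -> : minn j.+1 j = j by [lia]; move=> ns; apply: t_u_swap_None.
Qed.

(** * Lists as formal sums and the commutation of the two sums *)

Lemma uniq_pmap (T : eqType) (I : eqType) (f : I -> option T) r : uniq r ->
  (forall i j y, f i = Some y -> f j = Some y -> i = j) -> uniq (pmap f r).
Proof.
move=> + inj; elim: r => //= i r IH /andP [ir /IH ur].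
case E: (f i) => [y|] //=; rewrite ur andbT mem_pmap.
by apply: contra ir => /mapP [j jr /esym Ej]; rewrite (inj _ _ _ E Ej).
Qed.

(** Lists up to [perm_eq] act as formal sums with multiplicities, and this extends [F] linearly. *)
Definition bind_seq (S T : Type) (F : S -> seq T) s := [seq y | x <- s, y <- F x].

Lemma bind_seq_cat (S T : Type) (F : S -> seq T) s1 s2 :
  bind_seq F (s1 ++ s2) = bind_seq F s1 ++ bind_seq F s2.
Proof. exact: allpairs_cat. Qed.

Lemma perm_bind_seq (S T : eqType) (F : S -> seq T) s1 s2 :
  perm_eq s1 s2 -> perm_eq (bind_seq F s1) (bind_seq F s2).
Proof. by move=> s12; apply: perm_allpairs_dep. Qed.

Lemma bind_seq_pmap (I S T : Type) (f : I -> option S) (g : I -> S -> option T) r1 r2 :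
  bind_seq (fun y => pmap (g^~ y) r2) (pmap f r1) =
  pmap (fun p => obind (g p.2) (f p.1)) [seq (i, j) | i <- r1, j <- r2].
Proof.
elim: r1 => //= i r1 IH; rewrite pmap_cat -IH.
have -> : pmap (fun p => obind (g p.2) (f p.1)) [seq (i, j) | j <- r2] =
          if f i is Some y then pmap (g^~ y) r2 else [::].
  by elim: r2 {IH} => //= [|j r2 ->]; case: (f i).
by case: (f i) => [y|] //=; rewrite /bind_seq /= map_id.
Qed.

(** The sum over all indices, cut off at [N] to stay finite; undefined terms drop out. *)
Definition stepR N s := pmap (u_seq^~ s) (iota 1 N).
Definition stepL N s := pmap (t_op^~ s) (iota 1 N).

Lemma stepLR_comm N s :
  perm_eq (bind_seq (stepL N) (stepR N s)) (bind_seq (stepR N) (stepL N s)).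
Proof.
rewrite !bind_seq_pmap.
set pairs := [seq (i, j) | i <- iota 1 N, j <- iota 1 N].
have memP i j : ((i, j) \in pairs) = (i \in iota 1 N) && (j \in iota 1 N).
  apply/allpairsP/andP => [[[i' j'] [? ? [-> ->]]] //|[ir jr]].
  by exists (i, j).
(* The components are exchanged because the operator applied first is [u_op] on the left and [t_op]
   on the right. *)
pose sg p := ((conj_pair s p).2, (conj_pair s p).1).
have sgK : involutive sg.
  move=> [i j]; rewrite /sg /conj_pair /=; case E: (swapped i j s) => /=; first by rewrite E.
  by move: E; rewrite /swapped orbC minnC => ->.
have -> : pmap (fun p => obind (t_op p.2) (u_seq p.1 s)) pairs =
          pmap (fun p => obind (u_seq p.2) (t_op p.1 s)) (map sg pairs).
  have: all (fun p => (0 < p.1) && (0 < p.2)) pairs.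
    by apply/allP => -[i j]; rewrite memP !mem_iota /=; lia.
  elim: pairs {memP} => //= -[i j] l IH /= /andP [/andP [i0 j0] /IH ->].
  by rewrite t_u_conj.
apply: perm_pmap; apply: uniq_perm.
- by rewrite (map_inj_uniq (inv_inj sgK)) allpairs_uniq ?iota_uniq // => -[? ?] [? ?] _ _ [-> ->].
- by rewrite allpairs_uniq ?iota_uniq // => -[? ?] [? ?] _ _ [-> ->].
move=> p; rewrite -{1}(sgK p) (mem_map (inv_inj sgK)) /sg.
case: p => i j; rewrite /conj_pair; case: ifP => _ /=; rewrite !memP //.
by rewrite andbC.
Qed.

(** * Iterates of the sums *)

(** [step] receives the stage number because the entry put into a tableau depends on it. *)
Fixpoint level (T : Type) (step : nat -> T -> seq T) (x0 : T) n :=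
  if n is n'.+1 then bind_seq (step n') (level step x0 n') else [:: x0].

Lemma map_level (S T : Type) (sh : S -> T) step st x0 n :
  (forall n x, map sh (step n x) = st (sh x)) ->
  map sh (level step x0 n) = level (fun=> st) (sh x0) n.
Proof.
move=> H; elim: n => //= n <-.
by rewrite /bind_seq map_allpairs allpairs_mapl; congr flatten; apply: eq_map => x; rewrite /= H map_id.
Qed.

(** [del] recovers the object before the last step, so different predecessors never give the same
    object. *)
Lemma uniq_level (T : eqType) step (x0 : T) n (del : nat -> T -> T) :
  (forall m x, m < n -> x \in level step x0 m ->
     uniq (step m x) /\ {in step m x, forall y, del m y = x}) ->
  uniq (level step x0 n).
Proof.
elim: n => //= n IH H; apply: allpairs_uniq_dep => [|x xl|].
- by apply: IH => m x mn; apply: H; apply: ltnW.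
- by have [] := H n x (leqnn _) xl.
move=> _ _ /allpairsPdep [x [y [xl yx ->]]] /allpairsPdep [x' [y' [xl' yx' ->]]] /= yy'.
have [_ D] := H n x (leqnn _) xl; have [_ D'] := H n x' (leqnn _) xl'.
by rewrite -(D _ yx) -(D' _ yx') yy'.
Qed.

Lemma perm_level_LR N n :
  perm_eq (level (fun=> stepL N) [::] n) (level (fun=> stepR N) [::] n).
Proof.
have C l : perm_eq (bind_seq (stepR N) (bind_seq (stepL N) l))
                   (bind_seq (stepL N) (bind_seq (stepR N) l)).
  elim: l => //= s l IH.
  have bcons F : bind_seq F (s :: l) = F s ++ bind_seq F l :> seq (seq nat).
    by rewrite /bind_seq /= map_id.
  by rewrite !bcons !bind_seq_cat perm_cat // perm_sym stepLR_comm.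
(* The two sums agree on every iterate of [stepL]: commutation carries their agreement at [[::]]
   along. *)
have LR m : perm_eq (bind_seq (stepL N) (level (fun=> stepL N) [::] m))
                    (bind_seq (stepR N) (level (fun=> stepL N) [::] m)).
  elim: m => [|m IH] /=.
    rewrite /bind_seq /= !map_id !cats0; apply/permP => ?; congr count.
    (* On [[::]] only index 1 is defined, and both operators give [[:: 1]]. *)
    apply: eq_in_pmap => -[|[|i]]; rewrite mem_iota // => _.
    by rewrite /u_seq /u_op /= d_seqN // v_op_None.
  by apply: (perm_trans (perm_bind_seq _ IH)); rewrite perm_sym C.
elim: n => //= n IH; apply: (perm_trans (LR n)).
exact: perm_bind_seq.
Qed.

(** * Maximal chains as iterates of [stepR] *)

Lemma u_seqP i s s' : 0 < i -> u_seq i s = Some s' ->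
  sumn s' = (sumn s).+1 /\ last 0 s' = i.
Proof.
move=> i0; rewrite /u_seq /u_op.
case Ev: (v_op _ _) => [y|] //= [<-]; rewrite (sumn_v_op Ev) sumn_rcons last_rcons.
by split=> //; lia.
Qed.

Lemma last_le_sumn s : last 0 s <= sumn s.
Proof. by case/lastP: s => // s x; rewrite last_rcons sumn_rcons; lia. Qed.

Lemma stepRP N s s' : sumn s < N -> s' \in stepR N s <-> rcover s s'.
Proof.
move=> sN; rewrite mem_pmap; split.
  by move=> /mapP [i]; rewrite mem_iota => /andP [i0 _] /esym E; exists i.
move=> [i i0 E]; apply/mapP; exists i => //; rewrite mem_iota i0 /=.
(* The index is the last part of [s'], hence at most [sumn s' = (sumn s).+1 <= N]. *)
by have [Es <-] := u_seqP i0 E; have := last_le_sumn s'; lia.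
Qed.

Lemma uniq_stepR N s : uniq (stepR N s).
Proof.
have -> : stepR N s = pmap (fun i => if 0 < i then u_seq i s else None) (iota 1 N).
  by apply: eq_in_pmap => i; rewrite mem_iota => /andP [->].
apply: uniq_pmap; first exact: iota_uniq.
move=> i j y; case: ifP => // i0 Ei; case: ifP => // j0 Ej.
by have [_ <-] := u_seqP i0 Ei; have [_ <-] := u_seqP j0 Ej.
Qed.

Lemma cover_path_rcons x p y :
  cover_path x (rcons p y) <-> cover_path x p /\ rcover (last x p) y.
Proof. by elim: p x => [|z p IH] x /=; rewrite ?IH; tauto. Qed.

Lemma sumn_last_cover p : cover_path [::] p -> sumn (last [::] p) = size p.
Proof.
elim/last_ind: p => //= p y IH /cover_path_rcons [/IH E [i i0 /(u_seqP i0) [Es _]]].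
by rewrite last_rcons size_rcons -E.
Qed.

(** The initial [[::]] of a chain is not stored; it is the default of [last]. *)
Definition step_chain N (c : seq (seq nat)) := map (rcons c) (stepR N (last [::] c)).

Definition chains N := level (fun=> step_chain N) [::].

Lemma mem_chains N n c : n <= N ->
  c \in chains N n <-> cover_path [::] c /\ size c = n.
Proof.
elim: n c => [|n IH] c nN.
  by rewrite inE; split=> [/eqP ->|[_ /size0nil ->]].
have nN' := ltnW nN; split.
  move=> /allpairsPdep [p [_ [/(IH _ nN') [cp sp] /mapP [y ys ->] ->]]].
  rewrite size_rcons sp; split=> //; apply/cover_path_rcons; split=> //.
  by apply: (proj1 (stepRP _ _) ys); rewrite sumn_last_cover // sp.
case/lastP: c => [[_]|p y] //; rewrite size_rcons => -[/cover_path_rcons [cp py] [sp]].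
apply/allpairsPdep; exists p, (rcons p y); split=> //; first by apply/IH.
by apply/map_f/(proj2 (stepRP _ _)) => //; rewrite sumn_last_cover // sp.
Qed.

Lemma uniq_chains N n : uniq (chains N n).
Proof.
apply: (@uniq_level _ _ _ _ (fun _ c => rev (behead (rev c)))) => m x _ _; split.
  by rewrite map_inj_uniq ?uniq_stepR //; apply: rcons_injr.
by move=> _ /mapP [y _ ->]; rewrite rev_rcons /= revK.
Qed.

Lemma last_chains N n :
  map (last [::]) (chains N n) = level (fun=> stepR N) [::] n.
Proof.
rewrite (@map_level _ _ (last [::]) _ (stepR N)) // => _ c.
by rewrite -map_comp -[RHS]map_id; apply: eq_map => y; rewrite /= last_rcons.
Qed.

(** * Partial tableaux and the insertion of a smallest entry *)

(* Reading past the end of a row gives 0, below every entry, so the comparisons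
   themselves encode that the boxes exist. *)
Definition triple (r s : seq nat) :=
  all (fun c => (nth 0 s c.+1 < nth 0 r c) ==> (nth 0 s c.+1 < nth 0 r c.+1))
      (iota 0 (size s).-1).

Definition above (r s : seq nat) := (head 0 r < head 0 s) && triple r s.

Definition is_row (r : seq nat) := (r != [::]) && sorted gtn r.

(** The [n] largest entries of a tableau form such a partial tableau; [k] goes down as entries are
    inserted. *)
Definition is_tab k n tau :=
  [&& all is_row tau, pairwise above tau & perm_eq (flatten tau) (iota k n)].

Fixpoint put k c (tau : seq (seq nat)) :=
  if tau is r :: tau' then
    if size r == c then Some (rcons r k :: tau') else omap (cons r) (put k c tau')
  else None.

Definition insert_entry k j tau := if j == 1 then Some ([:: k] :: tau) else put k j.-1 tau.

Lemma shape_insert k j tau :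
  omap (map size) (insert_entry k j tau) = t_op j (map size tau).
Proof.
rewrite /insert_entry /t_op; case: eqP => // _.
elim: tau => //= r tau <-; case: eqP => [<-|_] /=; first by rewrite size_rcons.
by case: (put _ _ _).
Qed.

Lemma putP k c tau tau' : put k c tau = Some tau' <->
  exists A r B, [/\ tau = A ++ r :: B, tau' = A ++ rcons r k :: B, size r = c &
    all (fun x => size x != c) A].
Proof.
split.
  elim: tau tau' => //= r tau IH tau'; case: eqP => [rc [<-]|/eqP rc].
    by exists [::], r, tau.
  case E: (put k c tau) => [t|] //= [<-].
  have [A [r' [B [-> -> r'c Ac]]]] := IH _ E.
  by exists (r :: A), r', B; rewrite /= rc.
move=> [A [r [B [-> -> rc]]]]; elim: A => /= [|a A IH]; first by rewrite rc eqxx.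
by move=> /andP [/negPf -> /IH ->].
Qed.

Lemma lt_nth k c x : all (ltn k) x -> (k < nth 0 x c) = (c < size x).
Proof.
move=> /allP kx; case: (ltnP c (size x)) => cx; last by rewrite nth_default.
exact/kx/mem_nth.
Qed.

(** [k] lies below every entry of [y], as does the default 0 that it replaces. *)
Lemma triple_rcons_l k r y : all (ltn k) y -> triple (rcons r k) y = triple r y.
Proof.
move=> ky; apply: eq_in_all => c; rewrite mem_iota /= => cy.
have kc : k < nth 0 y c.+1 by rewrite lt_nth //; lia.
have yk : (nth 0 y c.+1 < k) = false by rewrite ltnNge (ltnW kc).
rewrite !nth_rcons; have [cr|rc|cr] := ltngtP c (size r).
- have [//|rc|E] := ltngtP c.+1 (size r); first by move: (leq_trans rc cr); rewrite ltnn.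
  by rewrite [nth 0 r c.+1]nth_default -?E // ltn0 yk.
- by rewrite [nth 0 r c]nth_default ?ltn0 // ltnW.
- by rewrite [nth 0 r c]nth_default ?cr // ltn0 -cr yk.
Qed.

(** The one new constraint is at the box of [k]: if [x] reaches the column before it, [x] must reach
    its column too. Since [k] lies below all of [x], this says that the lengths of [x] and [r]
    differ. *)
Lemma triple_rcons_r k (r x : seq nat) : all (ltn k) x -> r != [::] ->
  triple x (rcons r k) = triple x r && (size x != size r).
Proof.
move=> kx; rewrite -size_eq0 -lt0n => r0; rewrite /triple size_rcons /=.
have -> : iota 0 (size r) = iota 0 (size r).-1 ++ [:: (size r).-1].
  by rewrite -{1}(prednK r0) -addn1 iotaD.
rewrite all_cat /= andbT; congr (_ && _).
  apply: eq_in_all => c; rewrite mem_iota => cr.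
  have cr' : c.+1 < size r by lia.
  by rewrite nth_rcons cr'.
rewrite prednK // nth_rcons ltnn eqxx !lt_nth //.
by rewrite prednK //; case: ltngtP.
Qed.

Lemma head_rcons_cons (r : seq nat) k : r != [::] -> head 0 (rcons r k) = head 0 r.
Proof. by case: r. Qed.

Lemma pairwise_above_rcons k A (r : seq nat) B : r != [::] ->
  all (all (ltn k)) A -> all (all (ltn k)) B ->
  pairwise above (A ++ rcons r k :: B) =
  pairwise above (A ++ r :: B) && all (fun x => size x != size r) A.
Proof.
move=> r0 kA kB; rewrite !pairwise_cat !allrel_consr !pairwise_cons.
have -> : all (above (rcons r k)) B = all (above r) B.
  by apply: eq_in_all => y /(allP kB) ky; rewrite /above triple_rcons_l // head_rcons_cons.
have -> : all (above^~ (rcons r k)) A =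
          all (above^~ r) A && all (fun x => size x != size r) A.
  rewrite -all_predI; apply: eq_in_all => x /(allP kA) kx /=.
  by rewrite /above triple_rcons_r // head_rcons_cons // andbA.
by do !case: (all _ _) => //=; rewrite ?andbF ?andbT.
Qed.

Lemma is_row_rcons k (r : seq nat) : r != [::] -> all (ltn k) r -> is_row (rcons r k) = is_row r.
Proof.
case: r => // x r _ /allP kr; rewrite /is_row /= rcons_path /=.
by have /= -> := kr _ (mem_last x r); rewrite andbT.
Qed.

Lemma is_tab_gt k n tau : is_tab k.+1 n tau -> all (all (ltn k)) tau.
Proof.
move=> /and3P [_ _ /perm_mem E]; apply/allP => r rt; apply/allP => x xr.
have : x \in flatten tau by apply/flattenP; exists r.
by rewrite E mem_iota => /andP [].
Qed.

Lemma is_tab_rcons k n A (r : seq nat) B : r != [::] -> all (all (ltn k)) (A ++ r :: B) ->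
  is_tab k n.+1 (A ++ rcons r k :: B) =
  is_tab k.+1 n (A ++ r :: B) && all (fun x => size x != size r) A.
Proof.
move=> r0; rewrite all_cat /= => /and3P [kA kr kB].
rewrite /is_tab pairwise_above_rcons // !all_cat /= is_row_rcons //.
have -> : perm_eq (flatten (A ++ rcons r k :: B)) (k :: iota k.+1 n) =
          perm_eq (flatten (A ++ r :: B)) (iota k.+1 n).
  rewrite -[RHS](perm_cons k).
  suff /permPl -> : perm_eq (flatten (A ++ rcons r k :: B)) (k :: flatten (A ++ r :: B)) by [].
  by apply/permP => p; rewrite !flatten_cat -cats1 /= !count_cat /=; lia.
by do !case: (all _ _) => //=; rewrite ?andbF ?andbT.
Qed.

(** All other entries exceed [k], so neither the first column nor the triple condition restricts
    this new top row. *)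
Lemma is_tab_cons1 k n tau : all (all (ltn k)) tau ->
  is_tab k n.+1 ([:: k] :: tau) = is_tab k.+1 n tau.
Proof.
move=> kt; rewrite /is_tab /= perm_cons.
case rt: (all is_row tau) => //=; suff -> : all (above [:: k]) tau by [].
apply/allP => r rin; apply/andP; split.
  have := allP rt _ rin; have := allP kt _ rin.
  by case: r {rin} => //= x r /andP [].
apply/allP => c; rewrite mem_iota => cr; apply/implyP.
have : k < nth 0 r c.+1 by rewrite lt_nth ?(allP kt) //; lia.
by case: c {cr} => //= [|c]; [rewrite ltnNge => kr; rewrite ltnNge; lia | rewrite nth_nil].
Qed.

Lemma is_tab_insert k n j tau tau' : 0 < j -> is_tab k.+1 n tau ->
  insert_entry k j tau = Some tau' -> is_tab k n.+1 tau'.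
Proof.
move=> j0 tt; have kt := is_tab_gt tt; rewrite /insert_entry.
case: eqP => [_ [<-]|j1]; first by rewrite is_tab_cons1.
move=> /putP [A [r [B [Et -> rc Ac]]]]; subst tau.
have r0 : r != [::] by rewrite -size_eq0 rc; case: j j0 j1 {rc Ac} => [|[|]].
by rewrite is_tab_rcons // tt rc.
Qed.

(** The smallest entry [k] ends its row. If it is alone there, the row is the top one because the
    first column increases; otherwise it extends the topmost row of its length. *)
Lemma is_tab_inv k n tau' : is_tab k n.+1 tau' ->
  exists2 j, 0 < j & exists2 tau, is_tab k.+1 n tau & insert_entry k j tau = Some tau'.
Proof.
move=> tt; have /and3P [rows abv pe] := tt.
have ge : forall R x, R \in tau' -> x \in R -> k <= x.
  move=> R x Rt xR; have : x \in flatten tau' by apply/flattenP; exists R.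
  by rewrite (perm_mem pe) mem_iota => /andP [].
have : k \in flatten tau' by rewrite (perm_mem pe) mem_head.
move=> /flattenP [R Rt kR].
have ER : exists r, R = rcons r k /\ all (ltn k) r.
  have := allP rows _ Rt; rewrite /is_row => /andP [_].
  case/lastP: R kR Rt => // r x kR Rt.
  rewrite (sorted_pairwise (rev_trans ltn_trans)) -cats1 pairwise_cat allrel1r => /and3P [/allP rx _ _].
  have xk : x = k.
    move: kR; rewrite mem_rcons inE => /orP [/eqP -> //|/rx /= xk].
    by have := ge _ _ Rt (_ : x \in rcons r x); rewrite mem_rcons mem_head => /(_ isT); lia.
  by exists r; rewrite cats1 xk; split=> //; apply/allP => y /rx; rewrite xk.
have [r [Er kr]] := ER; subst R.
case/splitPr: Rt tt rows abv pe ge => A B tt rows abv pe ge.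
(* [k] occurs only once, so all remaining entries exceed it. *)
have cnt : count_mem k (flatten (A ++ r :: B)) = 0.
  have : count_mem k (k :: flatten (A ++ r :: B)) = count_mem k (iota k n.+1).
    move/permP: pe => <-; rewrite !flatten_cat /= !count_cat -cats1 !count_cat /= eqxx; lia.
  rewrite /= eqxx /= !add1n => -[->]; apply/eqP; rewrite -leqn0 leqNgt -has_count has_pred1 mem_iota; lia.
have kAB : all (all (ltn k)) (A ++ r :: B).
  apply/allP => R RAB; apply/allP => x xR /=.
  have xk : x != k.
    apply/eqP => Ex; subst x; move/eqP: cnt; rewrite -leqn0 leqNgt -has_count has_pred1.
    by move/negP; apply; apply/flattenP; exists R.
  suff : k <= x by rewrite leq_eqVlt eq_sym (negPf xk).
  move: RAB; rewrite mem_cat inE => /or3P [RA|/eqP Er|RB].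
  - by apply: (ge R) => //; rewrite mem_cat RA.
  - by apply: (ge (rcons r k)); rewrite ?mem_cat ?mem_head ?orbT // mem_rcons inE -Er xR orbT.
  - by apply: (ge R) => //; rewrite mem_cat inE RB !orbT.
have [r0|r0] := eqVneq r [::].
  subst r; have A0 : A = [::].
    case: A tt abv rows ge {pe cnt kAB} => // a A _ /=.
    rewrite all_cat /= => /andP [/and3P [_ /andP [+ _] _] _] /andP [/andP [a0 _] _] ge.
    have := ge a (head 0 a) (mem_head _ _); case: a a0 {ge} => //= x a _.
    by rewrite mem_head => /(_ isT); lia.
  subst A; exists 1 => //; exists B => //.
  by rewrite -is_tab_cons1.
move: tt; rewrite is_tab_rcons // => /andP [tt Ac].
exists (size r).+1 => //; exists (A ++ r :: B) => //.
rewrite /insert_entry eqSS size_eq0 (negPf r0); apply/putP.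
by exists A, r, B.
Qed.

(** Undoes an insertion of [k] without knowing the index [j]; a row emptied by the deletion
    disappears. *)
Definition del_entry k (tau : seq (seq nat)) := [seq r <- map (rem k) tau | r != [::]].

Lemma rem_id_gt k tau : all (all (ltn k)) tau -> map (rem k) tau = tau.
Proof.
elim: tau => //= r tau IH /andP [kr /IH ->]; rewrite rem_id //.
by apply/negP => /(allP kr); rewrite /= ltnn.
Qed.

Lemma del_insert k n j tau tau' : is_tab k.+1 n tau ->
  insert_entry k j tau = Some tau' -> del_entry k tau' = tau.
Proof.
move=> tt; have kt := is_tab_gt tt; have /and3P [rows _ _] := tt.
have rows0 : all (fun r => r != [::]) tau.
  by apply: sub_all rows => r /andP [].
rewrite /insert_entry /del_entry; case: eqP => [_ [<-]|_].
  by rewrite /= eqxx /= rem_id_gt //; apply/all_filterP.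
move=> /putP [A [r [B [Et -> _ _]]]]; subst tau.
have -> : map (rem k) (A ++ rcons r k :: B) = map (rem k) (A ++ r :: B).
  rewrite !map_cat /=; congr (_ ++ _ :: _).
  have : k \notin r.
    move: kt; rewrite all_cat /= => /and3P [_ kr _].
    by apply/negP => /(allP kr); rewrite /= ltnn.
  elim: r {tt rows rows0 kt} => /= [|x r IH]; first by rewrite eqxx.
  by rewrite inE negb_or eq_sym => /andP [/negPf -> /IH ->].
by rewrite rem_id_gt //; apply/all_filterP.
Qed.

(** * Enumeration of the tableaux *)

(** Only the part [j] gains multiplicity, so the shapes before and after an insertion determine
    [j]. *)
Lemma count_t_op i j s s' : 0 < j -> t_op j s = Some s' ->
  if i == j then count_mem i s < count_mem i s' else count_mem i s' <= count_mem i s.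
Proof.
case: j => // -[|j] _; rewrite /t_op /=.
  by case=> <- /=; case: eqVneq => [->|]; rewrite // eq_sym => /negPf ->.
elim: s s' => //= x s IH s'; case: eqP => [-> [<-] /=|_].
  by case: eqVneq => [->|]; lia.
case E: (incr_first _ s) => [t|] //= [<-] /=.
by move: (IH _ E); case: ifP; lia.
Qed.

Lemma t_op_inj s s' i j : 0 < i -> 0 < j ->
  t_op i s = Some s' -> t_op j s = Some s' -> i = j.
Proof.
move=> i0 j0 /(count_t_op i i0); rewrite eqxx => lti /(count_t_op i j0).
by case: eqP => // _; rewrite leqNgt lti.
Qed.

(** Ensures that cutting off the indices at [N] loses no insertion. *)
Lemma t_op_le_sumn j s s' : t_op j s = Some s' -> j <= sumn s'.
Proof.
case: j => // -[|j]; rewrite /t_op /=; first by case=> <-.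
elim: s s' => //= x s IH s'; case: eqP => [_ [<-]|_]; first exact: leq_addr.
by case E: (incr_first _ s) => [t|] //= [<-] /=; have := IH _ E; lia.
Qed.

(* Step n of the construction inserts the entry N - n. *)
Definition step_tab N n tau := pmap (fun j => insert_entry (N - n) j tau) (iota 1 N).

Definition tabs N := level (step_tab N) [::].

Lemma size_is_tab k n tau : is_tab k n tau -> sumn (map size tau) = n.
Proof. by move=> /and3P [_ _ /perm_size]; rewrite size_flatten size_iota. Qed.

Lemma mem_tabs N n tau : n <= N -> tau \in tabs N n <-> is_tab (N - n).+1 n tau.
Proof.
elim: n tau => [|n IH] tau nN.
  rewrite inE; split=> [/eqP -> //|/and3P [rows _ /perm_size /= /size0nil F]].
  by case: tau rows F => //= -[].
(* Before step [n] the entries are [N - n + 1, ..., N]; that step adds [N - n]. *)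
have -> : (N - n.+1).+1 = N - n by lia.
split=> [/allpairsPdep [t [y [/(IH _ (ltnW nN)) tt + ->]]]|].
  by rewrite mem_pmap => /mapP [j]; rewrite mem_iota => /andP [j0 _] /esym /(is_tab_insert j0 tt).
move=> tt'; have [j j0 [t tt E]] := is_tab_inv tt'.
apply/allpairsPdep; exists t, tau; split=> //; first by apply/IH => //; apply: ltnW.
rewrite mem_pmap; apply/mapP; exists j => //; rewrite mem_iota j0 /=.
have := shape_insert (N - n) j t; rewrite E /= => /esym /t_op_le_sumn.
by rewrite (size_is_tab tt'); lia.
Qed.

Lemma uniq_tabs N n : n <= N -> uniq (tabs N n).
Proof.
move=> nN; apply: (@uniq_level _ _ _ _ (fun m => del_entry (N - m))) => m x mn.
move=> /mem_tabs; rewrite (leq_trans (ltnW mn) nN) => /(_ isT) tx; split; last first.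
  by move=> y; rewrite mem_pmap => /mapP [j _ /esym]; apply: del_insert tx.
have -> : step_tab N m x =
    pmap (fun j => if 0 < j then insert_entry (N - m) j x else None) (iota 1 N).
  by apply: eq_in_pmap => j; rewrite mem_iota => /andP [->].
apply: uniq_pmap; first exact: iota_uniq.
move=> i j y; case: ifP => // i0 Ei; case: ifP => // j0 Ej.
apply: (@t_op_inj (map size x) (map size y)) => //.
  by rewrite -(shape_insert (N - m)) Ei.
by rewrite -(shape_insert (N - m)) Ej.
Qed.

Lemma shape_tabs N n : map (map size) (tabs N n) = level (fun=> stepL N) [::] n.
Proof.
rewrite (@map_level _ _ (map size) _ (stepL N)) // => m x.
rewrite /stepL /step_tab; elim: (iota 1 N) => //= j l <-.
by rewrite -(shape_insert (N - m)); case: (insert_entry _ _ _).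
Qed.

(** * Comparison with [SRCT] and the final count *)

Lemma nth_sizes r (tau : seq (seq nat)) : nth 0 (map size tau) r = size (nth [::] tau r).
Proof.
have [rt|rt] := ltnP r (size tau); first exact: nth_map.
by rewrite !nth_default ?size_map.
Qed.

Lemma SRCT_is_tab alpha tau : composition alpha ->
  SRCT alpha tau <-> is_tab 1 (sumn alpha) tau && (map size tau == alpha).
Proof.
move=> ca; split.
  move=> [sh pe rowd col tri]; rewrite sh eqxx andbT.
  have st : size alpha = size tau by rewrite -sh size_map.
  apply/and3P; split=> //.
    apply/(all_nthP [::]) => r rt; apply/andP; split.
      by rewrite -size_eq0 -nth_sizes sh -lt0n; apply: (allP ca); rewrite mem_nth // st.
    apply/(sortedP 0) => c cr; apply: rowd; first by rewrite st.
    by rewrite -sh nth_sizes.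
  apply/(pairwiseP [::]) => r s; rewrite !inE => rt st' rs; apply/andP; split.
    by have := col r s rs; rewrite st /tab_entry !nth0; apply.
  apply/allP => c; rewrite mem_iota => cs; apply/implyP => lt.
  (* Outside row [r] the entry reads 0, which exceeds no entry. *)
  have cr : c < nth 0 alpha r.
    by rewrite -sh nth_sizes ltnNge; apply: contraL lt => rc; rewrite (nth_default _ rc).
  have [] // := tri r s c rs _ cr _ lt; rewrite ?st //.
  by rewrite -sh nth_sizes; lia.
move=> /andP [/and3P [rows abv pe] /eqP sh].
have st : size alpha = size tau by rewrite -sh size_map.
split=> //.
- move=> r c; rewrite st -sh nth_sizes => rt cr.
  have /andP [_ /(sortedP 0)] := allP rows _ (mem_nth [::] rt); exact.
- move=> r s rs; rewrite st => sst.
  have /(pairwiseP [::]) /(_ r s) := abv; rewrite !inE /tab_entry !nth0.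
  by move=> /(_ (ltn_trans rs sst) sst rs) /andP [].
move=> r s c rs; rewrite st -sh !nth_sizes => sst cr cs lt.
have /(pairwiseP [::]) /(_ r s) := abv; rewrite !inE.
move=> /(_ (ltn_trans rs sst) sst rs) /andP [_ /allP /(_ c)].
rewrite mem_iota => /(_ _)/implyP /(_ lt) W.
have lt' : tab_entry tau s c.+1 < tab_entry tau r c.+1 by apply: W; lia.
split=> //; rewrite ltnNge; apply/negP => rc.
by move: lt'; rewrite /tab_entry (nth_default _ rc).
Qed.

(* The number of maximal chains from [::] to alpha in R_c equals the number of
   SRCT of shape alpha: both sets are finite, enumerated without repetition by
   finite lists of equal size. *)
Theorem theorem8p5 (alpha : seq nat) :
  composition alpha ->
  exists (Lc Lt : seq (seq (seq nat))),
    [/\ uniq Lc, (forall c, c \in Lc <-> max_chain alpha c),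
        uniq Lt, (forall t, t \in Lt <-> SRCT alpha t) &
        size Lc = size Lt].
Proof.
(* [N] is at once the number of steps, the largest entry and the bound on the indices. *)
move=> ca; pose N := sumn alpha.
exists (map (cons [::]) [seq c <- chains N N | last [::] c == alpha]).
exists [seq t <- tabs N N | map size t == alpha]; split.
- by rewrite map_inj_uniq ?filter_uniq ?uniq_chains // => x y [].
- move=> c; split=> [/mapP [p]|[p -> [cp lp]]].
    rewrite mem_filter => /andP [/eqP lp /(mem_chains _ (leqnn N)) [cp _]] ->.
    by exists p.
  apply: map_f; rewrite mem_filter lp eqxx; apply/mem_chains => //.
  by rewrite -(sumn_last_cover cp) lp.
- by rewrite filter_uniq ?uniq_tabs.
- move=> t; rewrite mem_filter SRCT_is_tab // andbC.
  have := mem_tabs t (leqnn N); rewrite subnn -/N => H.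
  by split=> /andP [/H -> ->].
(* The two sizes are the multiplicities of [alpha] in the [N]-th iterates of [stepR] and [stepL]. *)
rewrite size_map !size_filter.
have E := perm_level_LR N N; move/permP: E => /(_ (pred1 alpha)).
by rewrite -shape_tabs -last_chains !count_map => ->.
Qed.
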